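(* For all sufficiently large $n$, $r_3(4,P_n)< n^{21}$. More generally, for each $k \ge 3$ there exists $c>0$ such that for all sufficiently large $n$, $$\mathrm{twr}_{k-2}(n^{c}) < r_{k}(k+1, P_n) < \mathrm{twr}_{k-2}(n^{62}).$$
   Context: For $k\ge 2$, the $k$-uniform tight path $P_n$ has vertices $v_1<\cdots<v_n$ and edges $\{v_j,v_{j+1},\dots,v_{j+k-1}\}$ for $j=1,\dots,n-k+1$. Given a red/blue coloring of the $k$-subsets of $[N]$, a blue copy of $P_n$ is a sequence $x_1<\cdots<x_n$ in $[N]$ such that every $k$-set $\{x_j,\dots,x_{j+k-1}\}$ is blue. $r_k(k+1,P_n)$ is the minimum $N$ such that every red/blue coloring of the $k$-subsets of $[N]$ contains either $k+1$ vertices all of whose $k$-subsets are red (a red $K_{k+1}^{(k)}$) or a blue copy of $P_n$. The tower function is defined by $\mathrm{twr}_1(x)=x$ and $\mathrm{twr}_{i+1}(x)=2^{\mathrm{twr}_i(x)}$. *)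

(* Defs.v *)
From mathcomp Require Import all_boot all_order all_algebra.
From mathcomp Require Import reals exp.

Set Implicit Arguments.
Unset Strict Implicit.
Unset Printing Implicit Defensive.

Import Order.TTheory GRing.Theory Num.Theory.

(* A red/blue coloring of the k-subsets of [N] (with 'I_N as vertex set) is
   given by a map on all subsets of 'I_N, [true] standing for red and [false]
   for blue; only its values on sets of cardinality k are ever used. *)
Definition coloring (N : nat) : Type := {set 'I_N} -> bool.

Definition red_clique (k s N : nat) (chi : coloring N) : Prop :=
  exists S : {set 'I_N}, #|S| = s /\
    forall e : {set 'I_N}, e \subset S -> #|e| = k -> chi e = true.

Definition blue_tight_path (k n N : nat) (chi : coloring N) : Prop :=
  exists x : 'I_n -> 'I_N,
    (forall i j : 'I_n, (i < j)%N -> (x i < x j)%N) /\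
    forall j : nat, (j + k <= n)%N ->
      chi [set x i | i : 'I_n & (j <= i < j + k)%N] = false.

Definition ramsey_arrows (k s n N : nat) : Prop :=
  forall chi : coloring N, red_clique k s chi \/ blue_tight_path k n chi.

(* [is_ramsey_number k s n r] : r is the number r_k(s, P_n). *)
Definition is_ramsey_number (k s n r : nat) : Prop :=
  ramsey_arrows k s n r /\
  forall N : nat, ramsey_arrows k s n N -> (r <= N)%N.

(* The tower function is indexed from 1; the value at index 0 is junk. *)
Fixpoint twr (R : realType) (i : nat) (x : R) : R :=
  match i with
  | 0 | 1 => x
  | j.+1 => (2 `^ twr j x)%R
  end.

(* Main.v *)
Require Import Defs.
From mathcomp Require Import all_boot all_order all_algebra.
From mathcomp Require Import reals exp.
From mathcomp Require Import boolp zify.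

(* Upper bound for k = 3.  If there is no blue P_n, let f u v be the length of
   a longest blue path ending in u, v; a triple a < b < c with f b c <= f a b
   is red.  Suppose first that the pairs are 2-colored and that f increases
   along monochromatic triangles.  Among the pairs of one color, those of level
   at most the median into v, and those of higher level out of v, span
   neighborhoods of v with only half of the levels in that color; orienting
   every pair accordingly bounds the number of vertices polynomially.  Without
   a red K_4, this applies, for every threshold t, to the vertices u with
   f a u >= t and f u d <= t, colored by f <= t.  Hence almost every u has a
   threshold t(u) such that few in-pairs have level >= t(u) and few out-pairs
   have level < t(u), and few vertices can share the same threshold.

   Upper bound for larger k: Erdos-Rado end-homogeneous sets.

   Lower bound.  Color windows of walks on a set T so that two consecutive
   windows are never both red and blue walks are short; local minima do this
   for windows of length 3.  From 'I_w * bool pass to {ffun 'I_w -> bool}: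
   send a pair g != h to delta g h = (i, h i) with g i != h i.  Then
   delta g h != delta h k, so a coloring of k-windows lifts to one of
   (k+1)-windows on exponentially many points. *)

Set Implicit Arguments.
Unset Strict Implicit.
Unset Printing Implicit Defensive.

Import Order.TTheory GRing.Theory Num.Theory.

(** * Double counting in tournaments *)

Lemma leq_sum_card (T : finType) (A : {set T}) (F : T -> nat) (D : nat) :
  (forall x, x \in A -> F x <= D) -> \sum_(x in A) F x <= #|A| * D.
Proof.
move=> FD; rewrite -sum_nat_const; exact: leq_sum.
Qed.

Lemma card_sum_pred (T : finType) (A : {set T}) (P : pred T) :
  #|[set x in A | P x]| = \sum_(x in A) (P x : nat).
Proof.
rewrite -sum1_card [RHS](big_mkcond (fun x => x \in A)) /=.
rewrite big_mkcond /=; apply: eq_bigr => x _.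
by rewrite inE; case: (x \in A); case: (P x).
Qed.

(** The out-degrees add up to at most [#|S| * D], while the relation and its converse together
    account for all [#|S| * #|S|.-1] ordered pairs. *)
Lemma tournament_bound (T : finType) (S : {set T}) (E : rel T) (D : nat) :
  {in S &, forall u v, u != v -> E u v || E v u} ->
  (forall v, v \in S -> #|[set u in S | E v u]| <= D) ->
  #|S| <= (2 * D).+1.
Proof.
move=> Etot Edeg.
have sumE : \sum_(v in S) \sum_(u in S) (E v u : nat) <= #|S| * D.
  by apply: leq_sum_card => v vS; rewrite -card_sum_pred; exact: Edeg.
have sumE' : \sum_(v in S) \sum_(u in S) (E u v : nat) <= #|S| * D.
  by rewrite exchange_big.
have low : #|S| * #|S|.-1 <=
    \sum_(v in S) \sum_(u in S) (E v u + E u v).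
  rewrite -sum_nat_const; apply: leq_sum => v vS.
  rewrite (cardsD1 v) vS add1n -pred_Sn -sum1_card [leqRHS](big_setD1 v vS) /=.
  apply: leq_trans _ (leq_addl _ _); apply: leq_sum => u.
  rewrite !inE => /andP[uv uS].
  by have := Etot _ _ uS vS uv; case: (E u v); case: (E v u).
have : #|S| * #|S|.-1 <= #|S| * (2 * D).
  apply: leq_trans low _.
  under eq_bigr do rewrite big_split /=.
  rewrite big_split /=; lia.
case: (posnP #|S|) => [-> //|S0]; rewrite leq_pmul2l //; lia.
Qed.

(** * Levels increasing along monochromatic triangles *)

Section Levels.

Variable N : nat.
Implicit Types (S : {set 'I_N}) (r : rel 'I_N) (f : 'I_N -> 'I_N -> nat).

(* A range of 2 ^ i - 1 levels splits into its median and two ranges of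
   2 ^ i.-1 - 1 levels. *)
Lemma increasing_levels_bound S r f (i j p q : nat) :
  {in S & &, forall u v w : 'I_N, u < v -> v < w ->
     r u v = r v w -> r u v = r u w -> f u v < f v w} ->
  {in S &, forall u v : 'I_N, u < v ->
     if r u v then p <= f u v < p + (2 ^ i).-1
     else q <= f u v < q + (2 ^ j).-1} ->
  #|S| <= 16 ^ (i + j).
Proof.
have [s] := ubnP (i + j); elim: s => // s IHs in S i j p q *.
rewrite ltnS => ijs mono lev.
pose half (k p : nat) := p + (2 ^ k.-1).-1.
(* A pair [u < v] is an arc out of [v] if its level is at most the median of its color, and an arc
   out of [u] otherwise. *)
pose E (v u : 'I_N) := if (u < v) then
   f u v <= (if r u v then half i p else half j q)
  else (v < u) && ((if r v u then half i p else half j q) < f v u).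
pose D := 16 ^ (i + j).-1.
(* Induction for a set where color [c1] uses only one half of its range, the upper one if [c2]; that
   color's exponent drops by one, so it must not already be 0. *)
have sub c1 c2 (A : {set 'I_N}) : A \subset S ->
   (forall u v, u \in A -> v \in A -> u < v -> r u v = c1 ->
      if c2 then half (if c1 then i else j) (if c1 then p else q) < f u v
      else f u v < half (if c1 then i else j) (if c1 then p else q)) ->
   A = set0 \/ 0 < (if c1 then i else j) -> #|A| <= D.
  move=> AS Alev [->|ci]; first by rewrite cards0.
  have {ci} [k kE] : exists k, (if c1 then i else j) = k.+1.
    by exists (if c1 then i else j).-1; rewrite prednK.
  have pk : 2 ^ k.+1 = 2 * 2 ^ k by rewrite expnS.
  have pk0 : 0 < 2 ^ k by rewrite expn_gt0.
  pose p' := if c2 then p + 2 ^ k else p.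
  pose q' := if c2 then q + 2 ^ k else q.
  have sA := subsetP AS.
  rewrite /D.
  have -> : (i + j).-1 = if c1 then k + j else i + k.
    by case: c1 kE {Alev} => ->; lia.
  case: c1 Alev kE => Alev kE.
    apply: (IHs A k j p' q); first by lia.
      by move=> u v w /sA uS /sA vS /sA wS; apply: mono.
    move=> u v uA vA uv; have := lev u v (sA _ uA) (sA _ vA) uv.
    have := Alev u v uA vA uv; rewrite kE /half /= /p'.
    by case: (r u v) => // /(_ erefl); case: (c2) => /=; lia.
  apply: (IHs A i k p q'); first by lia.
    by move=> u v w /sA uS /sA vS /sA wS; apply: mono.
  move=> u v uA vA uv; have := lev u v (sA _ uA) (sA _ vA) uv.
  have := Alev u v uA vA uv; rewrite kE /half /= /q'.
  by case: (r u v) => // /(_ erefl); case: (c2) => /=; lia.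
have Edeg v : v \in S -> #|[set u in S | E v u]| <= 4 * D.
  move=> vS.
  (* The neighbors of [v] are split by color [c1] and by side, [c2] meaning after [v]. By [mono], a
     pair of color [c1] inside a class lies above the median if [c2], and below it otherwise. *)
  pose A c1 c2 := [set u in S | E v u & if c2 then (v < u) && (r v u == c1)
     else (u < v) && (r u v == c1)].
  have AD c1 c2 : #|A c1 c2| <= D.
    apply: (sub c1 c2).
    - by apply/subsetP => u; rewrite inE => /andP[].
    - move=> u w; rewrite !inE => /andP[uS /andP[Eu Hu]] /andP[wS /andP[Ew Hw]] uw ruw.
      case: c2 Hu Hw => /andP[vu /eqP ru] /andP[vw /eqP rw].
        have := mono v u w vS uS wS vu uw; rewrite ruw ru rw => /(_ erefl erefl).
        move: Eu; rewrite /E ltnNge (ltnW vu) /= vu /= ru.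
        by case: c1 {ruw ru rw} => /=; lia.
      have := mono u w v uS wS vS uw vw; rewrite ruw ru rw => /(_ erefl erefl).
      move: Ew; rewrite /E vw rw.
      by case: c1 {ruw ru rw} => /=; lia.
    - case: (posnP (if c1 then i else j)); last by right.
      move=> k0; left; apply/setP => u; rewrite !inE; apply/negP.
      move=> /andP[uS /andP[_]]; case: c2 => /andP[uv /eqP ru].
        by have := lev _ _ vS uS uv; rewrite ru; case: c1 k0 {ru} => -> /=; lia.
      by have := lev _ _ uS vS uv; rewrite ru; case: c1 k0 {ru} => -> /=; lia.
  apply: (@leq_trans (#|A true true :|: A true false :|: (A false true :|: A false false)|)).
    apply: subset_leq_card; apply/subsetP => u; rewrite !inE => /andP[-> Eu].
    rewrite Eu /=; move: Eu; rewrite /E.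
    case: ltngtP => //= uv _; by [case: (r u v)|case: (r v u)].
  have [+ _] := leq_card_setU (A true true :|: A true false) (A false true :|: A false false).
  have [+ _] := leq_card_setU (A true true) (A true false).
  have [+ _] := leq_card_setU (A false true) (A false false).
  have := AD true true; have := AD true false; have := AD false true.
  have := AD false false; lia.
have Etot : {in S &, forall u v, u != v -> E u v || E v u}.
  move=> u v _ _ /negPf uv; rewrite /E.
  case: (ltngtP u v) => [||/val_inj/eqP] //=; rewrite ?uv //; 
   move=> _; case: leqP => //; rewrite ?orbT //.
have := tournament_bound Etot Edeg.
rewrite /D; case: (posnP (i + j)) => [ij0|ij].
  have [i0 j0] : i = 0 /\ j = 0 by lia.
  move: lev; rewrite i0 j0 => lev.
  move=> _; rewrite leqNgt; apply/negP => S1.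
  have [u [v [uS vS /negPf uv]]] : exists u v, [/\ u \in S, v \in S & u != v].
    by move/card_gt1P: S1 => [u [v [? ? ?]]]; exists u, v.
  case: (ltngtP u v) => [uv'|vu|/val_inj/eqP]; last by rewrite uv.
    by have := lev _ _ uS vS uv'; case: ifP; lia.
  have := lev _ _ vS uS vu; case: ifP; lia.
(* Four classes give out-degree at most [4 * D], hence [8 * D + 1 <= 16 * D] vertices. *)
rewrite -[in X in _ -> X](prednK ij) expnS.
have : 0 < 16 ^ (i + j).-1 by rewrite expn_gt0.
lia.
Qed.

End Levels.

(** * Thresholds: a polynomial bound when no four vertices descend *)

Section FourVertices.

Variables (N : nat) (X : {set 'I_N}) (f : 'I_N -> 'I_N -> nat) (m i : nat).

Hypothesis m_lt : m < 2 ^ i.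
Hypothesis f_lt : {in X &, forall u v : 'I_N, u < v -> f u v < m}.
Hypothesis no_descent : forall a b c d : 'I_N,
  [/\ a \in X, b \in X, c \in X & d \in X] -> [/\ a < b, b < c & c < d] ->
  ~~ [&& f b c <= f a b, f b d <= f a b, f c d <= f a c & f c d <= f b c].

Let F := 16 ^ (i + i).

(** On a triangle [u < v < w] with all levels at most [t], failure to increase contradicts
    [no_descent] for [a, u, v, w]; with all levels above [t], it does so for [u, v, w, d]. *)
Lemma between_bound (a d : 'I_N) (t : nat) : a \in X -> d \in X ->
  #|[set u in X | ((a < u) && (t <= f a u)) && ((u < d) && (f u d <= t))]| <= F.
Proof.
move=> aX dX; apply: (@increasing_levels_bound _ _ (fun u v => f u v <= t) f i i 0 0).
  move=> u v w; rewrite !inE => /and3P[uX /andP[au tau] /andP[ud udt]].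
  move=> /and3P[vX /andP[av tav] /andP[vd vdt]].
  move=> /and3P[wX /andP[aw taw] /andP[wd wdt]] uv vw r1 r2.
  rewrite ltnNge; apply/negP => le.
  case: (leqP (f u v) t) r1 r2 => uvt.
    move/esym => vwt /esym uwt.
    have /negP[] := no_descent (And4 aX uX vX wX) (And3 au uv vw).
    by apply/and4P; split=> //; lia.
  move/esym/negbT; rewrite -ltnNge => vwt /esym/negbT; rewrite -ltnNge => uwt.
  have /negP[] := no_descent (And4 uX vX wX dX) (And3 uv vw wd).
  by apply/and4P; split=> //; lia.
move=> u v; rewrite !inE => /andP[uX _] /andP[vX _] uv.
by have := f_lt uX vX uv; case: ifP; lia.
Qed.

Lemma no_descent_bound : #|X| < 2048 * m.+1 ^ 3 * 16 ^ (i + i).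
Proof.
rewrite ltnNge; apply/negP => XF; rewrite -/F in XF.
have F0 : 0 < F by rewrite expn_gt0.
(* [D] is what counts as many neighbors. The 2048 in the bound is 16 times the 128 of [DF], which
   makes the bad vertices negligible in the final count. *)
pose D := #|X| %/ (16 * m.+1).
have XD : 16 * m.+1 * D <= #|X| by rewrite mulnC leq_divM.
have DX : #|X| < 16 * m.+1 * D.+1 by rewrite mulnC ltn_ceil.
have DF : 128 * m.+1 ^ 2 * F <= D.
  by rewrite leq_divRL //; apply: leq_trans XF; rewrite expnS; lia.
pose In t (u : 'I_N) := [set a in X | (a < u) && (t <= f a u)].
pose Out t (u : 'I_N) := [set d in X | (u < d) && (f u d <= t)].
pose Bad t := [set u in X | (D <= #|In t u|) && (D <= #|Out t u|)].
(* Each bad [u] is the middle of at least [D ^ 2] triples [a, u, d], and [between_bound] allows at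
   most [F] middles for each [a, d]. *)
have badD t : #|Bad t| * D ^ 2 <= #|X| ^ 2 * F.
  have low : #|Bad t| * D ^ 2 <= \sum_(u in X) #|In t u| * #|Out t u|.
    rewrite [leqRHS](big_setID (Bad t)) /=.
    apply: leq_trans (leq_addr _ _).
    have -> : X :&: Bad t = Bad t.
      by apply/setIidPr/subsetP => u; rewrite inE => /andP[].
    rewrite -sum_nat_const; apply: leq_sum => u; rewrite inE => /and3P[_ h1 h2].
    by rewrite -mulnn leq_mul.
  apply: leq_trans low _.
  have -> : \sum_(u in X) #|In t u| * #|Out t u| =
    \sum_(a in X) \sum_(d in X) #|[set u in X | ((a < u) && (t <= f a u)) && ((u < d) && (f u d <= t))]|.
    under eq_bigr => u _ do rewrite !card_sum_pred big_distrlr /=.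
    rewrite exchange_big /=; apply: eq_bigr => a _.
    rewrite exchange_big /=; apply: eq_bigr => d _.
    rewrite card_sum_pred; apply: eq_bigr => u _.
    by case: (_ && _); case: (_ && _).
  rewrite -mulnn -mulnA; apply: leq_sum_card => a aX.
  by apply: leq_sum_card => d dX; apply: between_bound.
have bad_bound t : #|Bad t| <= 1024 * m.+1 ^ 2 * F.
  rewrite -(@leq_pmul2r (D ^ 2)); last by rewrite expn_gt0; lia.
  apply: leq_trans (badD t) _.
  have : #|X| <= 32 * m.+1 * D by nia.
  rewrite -leq_sqr => h; apply: leq_trans (leq_mul h (leqnn F)) _.
  by rewrite !expnMn; lia.
(* Vertices with threshold [t]: few in-pairs of level at least [t] and few out-pairs of level below
   [t]. Orienting pairs by [t] gives them degree at most [D + D] within [W t]. *)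
pose W (t : 'I_m.+1) := [set u in X | (#|In t u| < D) &&
    [forall s : 'I_m.+1, (s < t) ==> (#|Out s u| < D)]].
have W_bound t : #|W t| <= (2 * (D + D)).+1.
  pose E (v u : 'I_N) := ((u < v) && (t <= f u v)) || ((v < u) && (f v u < t)).
  apply: (@tournament_bound _ _ E).
    move=> u v _ _ /negPf uv; rewrite /E.
    case: (ltngtP u v) => [||/val_inj/eqP] //=; rewrite ?uv //;
    by move=> _; rewrite ?orbF; case: leqP; rewrite ?orbT.
  move=> v; rewrite inE => /and3P[vX Inv /forallP Outv].
  apply: (@leq_trans #|In t v :|: (if (t : nat) is t'.+1 then Out t' v else set0)|).
    apply: subset_leq_card; apply/subsetP => u; rewrite !inE => /andP[/andP[uX _]].
    rewrite /E uX => /orP[-> //|/andP[vu]] ft; apply/orP; right.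
    by case: (t : nat) ft => // t'; rewrite inE uX vu ltnS.
  have [+ _] := leq_card_setU (In t v) (if (t : nat) is t'.+1 then Out t' v else set0).
  move/leq_trans; apply; apply: leq_add; first exact: ltnW.
  case tE: (t : nat) => [|t']; first by rewrite cards0.
  have t'm : t' < m.+1 by rewrite ltnW // -tE.
  by have := Outv (Ordinal t'm); rewrite /= tE ltnSn => /ltnW.
have cover : X \subset \bigcup_(t : 'I_m.+1) (W t :|: Bad t).
  apply/subsetP => u uX; apply/bigcupP.
  (* The threshold of [u] is the least [t] with [In t u] small; it exists since no level reaches
     [m]. Every [s < t] has [In s u] large, so a large [Out s u] puts [u] in [Bad s]. *)
  have tm : exists t, (#|In t u| < D) && (t <= m).
    exists m; rewrite leqnn andbT (_ : In m u = set0) ?cards0; first by lia.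
    apply/setP => a; rewrite !inE; apply/negP => /and3P[aX au].
    by have := f_lt aX uX au; lia.
  case: (ex_minnP tm) => t /andP[tD tm'] tmin.
  case: (boolP [exists s : 'I_m.+1, (s < t) && (D <= #|Out s u|)]).
    move/existsP => [s /andP[st sD]]; exists s => //.
    rewrite !inE uX /= sD andbT; apply/orP; right.
    rewrite leqNgt; apply/negP => h.
    by have := tmin s; rewrite h -ltnS ltn_ord => /(_ isT); lia.
  rewrite negb_exists => /forallP h.
  have tm'' : t < m.+1 by [].
  exists (Ordinal tm'') => //; rewrite !inE uX /= tD /=; apply/orP; left.
  apply/forallP => s; apply/implyP => st; have := h s; rewrite st /=; lia.
have : #|X| <= m.+1 * ((2 * (D + D)).+1 + 1024 * m.+1 ^ 2 * F).
  apply: leq_trans (subset_leq_card cover) _.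
  apply: leq_trans (_ : \sum_(t : 'I_m.+1) #|W t :|: Bad t| <= _).
    elim/big_rec2: _ => [|t n A _ h]; first by rewrite cards0.
    have [+ _] := leq_card_setU (W t :|: Bad t) A; lia.
  set B := (_ + _); have -> : m.+1 * B = \sum_(t < m.+1) B.
    by rewrite big_const_ord iter_addn_0 mulnC.
  apply: leq_sum => t _; rewrite /B.
  have [+ _] := leq_card_setU (W t) (Bad t).
  have := W_bound t; have := bad_bound t; lia.
move/(leq_trans XD); rewrite [16 * _]mulnC -mulnA leq_pmul2l //.
have : 0 < m.+1 ^ 2 * F by rewrite muln_gt0 expn_gt0 F0.
rewrite -!mulnA in DF *; lia.
Qed.

End FourVertices.

(** * Triples: blue path lengths as levels *)

Definition red_clique_in (k s N : nat) (chi : coloring N) (X : {set 'I_N}) :=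
  exists S : {set 'I_N}, [/\ S \subset X, #|S| = s &
    forall e : {set 'I_N}, e \subset S -> #|e| = k -> chi e].

Definition blue_path_in (k n N : nat) (chi : coloring N) (X : {set 'I_N}) :=
  exists x : nat -> 'I_N, [/\ forall i, i < n -> x i \in X,
    forall i j, i < j < n -> x i < x j &
    forall j, j + k <= n -> ~~ chi [set a in map x (iota j k)]].

(** Relative to a subset [X], so that stepping up can apply it inside an end-homogeneous set. *)
Definition clique_or_path (k n M : nat) :=
  forall (N : nat) (X : {set 'I_N}) (chi : coloring N), M <= #|X| ->
    red_clique_in k k.+1 chi X \/ blue_path_in k n chi X.

Section Triples.

Variables (N : nat) (X : {set 'I_N}) (chi : coloring N).

(** [l] counts the vertices of a blue path before its last two, [u] and [v]; such a path has [l + 2]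
    vertices. *)
Fixpoint reach (l : nat) (u v : 'I_N) : bool :=
  if l is l'.+1 then
    [exists t in X, [&& t < u, ~~ chi [set t; u; v] & reach l' t u]]
  else true.

Lemma reach_blue_path (l : nat) (u v : 'I_N) :
  u \in X -> v \in X -> u < v -> reach l u v ->
  exists x : nat -> 'I_N, [/\ x l = u, x l.+1 = v,
    forall i, i < l.+2 -> x i \in X,
    forall i j, i < j < l.+2 -> x i < x j &
    forall j, j + 3 <= l.+2 -> ~~ chi [set a in map x (iota j 3)]].
Proof.
elim: l u v => [|l IHl] u v uX vX uv.
  exists (fun i => if i is 0 then u else v); split=> //.
  - by case.
  - by move=> i j ij; have [-> ->] : i = 0 /\ j = 1 by lia.
  - by move=> j; lia.
move=> /existsP[t /and4P[tX tu tuv /(IHl _ _ tX uX tu)]].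
move=> [x [xl xl1 xX x_lt xb]].
pose y i := if i == l.+2 then v else x i.
have yE i : i < l.+2 -> y i = x i by rewrite /y; case: eqP => //; lia.
have yl : y l.+2 = v by rewrite /y eqxx.
have u_max i : i < l.+2 -> x i <= u.
  rewrite ltnS leq_eqVlt => /orP[/eqP ->|il]; first by rewrite xl1.
  by rewrite -xl1 ltnW // x_lt // il ltnSn.
exists y; split=> //.
- by rewrite yE.
- move=> i; rewrite ltnS leq_eqVlt => /orP[/eqP ->|il]; first by rewrite yl.
  by rewrite yE // xX.
- move=> i j /andP[ij]; rewrite ltnS leq_eqVlt => /orP[/eqP jl|jl].
    by rewrite jl yl yE -?jl // (leq_ltn_trans _ uv) // u_max -?jl.
  by rewrite !yE ?x_lt ?ij //; apply: ltn_trans jl.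
- move=> j jl; case: (leqP (j + 3) l.+2) => [jl'|lj].
    suff -> : map y (iota j 3) = map x (iota j 3) by apply: xb.
    by apply/eq_in_map => i; rewrite mem_iota => ?; rewrite yE //; lia.
  have -> : j = l by lia.
  have -> // : [set a in [seq y i | i <- iota l 3]] = [set t; u; v].
  by apply/setP => a; rewrite /= !inE yl !yE // xl xl1 orbA.
Qed.

Lemma card3_subset_set4 (a b c d : 'I_N) (e : {set 'I_N}) :
  e \subset [set a; b; c; d] -> #|e| = 3 -> #|[set a; b; c; d]| = 4 ->
  [\/ e = [set a; b; c], e = [set a; b; d], e = [set a; c; d] | e = [set b; c; d]].
Proof.
move=> eS e3 S4.
have : #|[set a; b; c; d] :\: e| = 1.
  by rewrite cardsD (setIidPr eS) e3 S4.
move/eqP/cards1P => [x Sx].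
have xS : x \in [set a; b; c; d].
  have : x \in [set a; b; c; d] :\: e by rewrite Sx inE.
  by rewrite inE => /andP[].
have {Sx} eE : e = [set a; b; c; d] :\ x.
  by rewrite -Sx setDDr setDv set0U; apply/esym/setIidPr.
have : uniq [:: a; b; c; d].
  apply/card_uniqP; rewrite /= -[RHS]S4; apply: eq_card => y.
  by rewrite !inE !orbA.
rewrite /= !inE !negb_or andbT -!andbA.
case/and5P => /negPf ab /negPf ac /negPf ad /negPf bc /andP[/negPf bd /negPf cd].
have [ba ca da] : [/\ (b == a) = false, (c == a) = false & (d == a) = false].
  by rewrite !(eq_sym _ a).
have [cb db dc] : [/\ (c == b) = false, (d == b) = false & (d == c) = false].
  by rewrite !(eq_sym _ b) (eq_sym d).
have neqs := (ab, ac, ad, bc, bd, cd, (ba, ca, da, cb, db, dc)).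
move: xS; rewrite !inE -!orbA eE => /or4P[] /eqP ->.
- apply: Or44; apply/setP => y; rewrite !inE.
  by case: (eqVneq y a) => [->|_]; rewrite /= ?neqs ?orbF.
- apply: Or43; apply/setP => y; rewrite !inE.
  by case: (eqVneq y b) => [->|_]; rewrite /= ?neqs ?orbF.
- apply: Or42; apply/setP => y; rewrite !inE.
  by case: (eqVneq y c) => [->|_]; rewrite /= ?neqs ?orbF.
- apply: Or41; apply/setP => y; rewrite !inE.
  by case: (eqVneq y d) => [->|_]; rewrite /= ?neqs ?orbF.
Qed.

End Triples.

Lemma clique_or_path3 (n i : nat) : 2 <= n < 2 ^ i ->
  clique_or_path 3 n (2048 * n.+1 ^ 3 * 16 ^ (i + i)).
Proof.
move=> /andP[n2 ni] N X chi XM.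
case: (boolP [exists u in X, [exists v in X, (u < v) && reach X chi n.-2 u v]]).
  move=> /existsP[u /andP[uX /existsP[v /and3P[vX uv]]]].
  move/(reach_blue_path uX vX uv) => [x [_ _]].
  have -> : n.-2.+2 = n by lia.
  by move=> xX x_lt xb; right; exists x.
move=> nopath; left.
(* The value [n.-2] would give a blue path on [n] vertices, so [f] stays below it and [(f t u).+1]
   is still in the range of the maximum. *)
pose f u v := \max_(l < n.-1 | reach X chi l u v) l.
have f_reach u v : reach X chi (f u v) u v.
  have l0 : 0 < n.-1 by lia.
  have [|l rl fE] := @eq_bigmax_cond 'I_(n.-1) [pred l : 'I_(n.-1) | reach X chi l u v] val.
    by apply/card_gt0P; exists (Ordinal l0).
  by rewrite /f fE.
have f_lt u v : u \in X -> v \in X -> u < v -> f u v < n.-2.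
  move=> uX vX uv.
  have : f u v <= n.-2 by apply/bigmax_leqP => l _; have := ltn_ord l; lia.
  rewrite leq_eqVlt => /orP[/eqP fE|//].
  case/existsP: nopath; exists u; rewrite uX; apply/existsP; exists v.
  by rewrite vX uv -fE f_reach.
have f_blue t u v : t \in X -> u \in X -> v \in X -> t < u -> u < v ->
  f u v <= f t u -> chi [set t; u; v].
  move=> tX uX vX tu uv; apply: contraTT => blue; rewrite -ltnNge.
  have ftu : (f t u).+1 < n.-1 by have := f_lt t u tX uX tu; lia.
  apply: (@leq_bigmax_cond _ _ (fun l : 'I_(n.-1) => l : nat) (Ordinal ftu)) => /=.
  by apply/existsP; exists t; rewrite tX tu blue f_reach.
(* The four inequalities of [desc] make all four triples red. *)
pose desc (q : 'I_N * 'I_N * 'I_N * 'I_N) := let: (a, b, c, d) := q in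
  [&& [&& a \in X, b \in X, c \in X & d \in X], [&& a < b, b < c & c < d] &
  [&& f b c <= f a b, f b d <= f a b, f c d <= f a c & f c d <= f b c]].
case: (pickP desc) => [[[[a b] c] d] /=|nodesc]; last first.
  suff : #|X| < 2048 * n.+1 ^ 3 * 16 ^ (i + i) by rewrite ltnNge XM.
  apply: (no_descent_bound (f := f)) => //.
    by move=> u v uX vX uv; have := f_lt u v uX vX uv; lia.
  move=> a b c d [aX bX cX dX] [ab bc cd].
  by have := nodesc (a, b, c, d); rewrite /= aX bX cX dX ab bc cd /= => ->.
move=> /and3P[/and4P[aX bX cX dX] /and3P[ab bc cd] /and4P[h1 h2 h3 h4]].
have ac := ltn_trans ab bc; have bd := ltn_trans bc cd.
have S4 : #|[set a; b; c; d]| = 4.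
  have: uniq [:: a; b; c; d].
    rewrite /= !inE -!(inj_eq val_inj) /=; lia.
  by move/card_uniqP => /= <-; apply: eq_card => y; rewrite !inE !orbA.
exists [set a; b; c; d]; split=> //.
  by apply/subsetP => y; rewrite !inE -!orbA => /or4P[] /eqP ->.
move=> e eS e3; case: (card3_subset_set4 eS e3 S4) => ->; exact: f_blue.
Qed.

(** * Stepping up with end-homogeneous sets *)

Lemma constant_subset (S : eqType) (U : finType) (G : S -> U -> bool) (s : seq S)
    (C : {set U}) :
  exists C' : {set U}, [/\ C' \subset C, #|C| <= #|C'| * 2 ^ size s &
    {in s, forall g, {in C' &, forall y z, G g y = G g z}}].
Proof.
elim: s C => [|g s IHs] C; first by exists C; split; rewrite // expn0 muln1.
(* Keep the majority value of [g]: each function costs a factor of at most 2. *)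
have [b Cb] : exists b, #|C| <= 2 * #|[set y in C | G g y == b]|.
  have := cardsID [set y | G g y] C; case: (leqP #|C| (2 * #|C :&: [set y | G g y]|)) => h hC.
    exists true; apply: leq_trans h _; rewrite leq_mul2l subset_leq_card ?orbT //.
    by apply/subsetP => y; rewrite !inE => /andP[-> ->].
  exists false; apply: leq_trans (_ : _ <= 2 * #|C :\: [set y | G g y]|) _; first lia.
  rewrite leq_mul2l subset_leq_card ?orbT //.
  by apply/subsetP => y; rewrite !inE => /andP[/negPf -> ->].
have [C' [C'C cC' const]] := IHs [set y in C | G g y == b].
exists C'; split.
- by apply: subset_trans C'C _; apply/subsetP => y; rewrite inE => /andP[].
- by apply: leq_trans Cb _; rewrite /= expnS; lia.
- move=> h; rewrite inE => /orP[/eqP ->|]; last exact: const.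
  move=> y z /(subsetP C'C); rewrite inE => /andP[_ /eqP ->].
  by move/(subsetP C'C); rewrite inE => /andP[_ /eqP ->].
Qed.

Lemma bin_leq_exp (n k : nat) : 'C(n, k) <= n ^ k.
Proof.
apply: leq_trans (leq_pmulr _ (fact_gt0 k)) _; rewrite bin_ffact.
elim: k n => [|k IHk] n; first by rewrite ffactn0.
rewrite ffactnS expnS leq_mul2l (leq_trans (IHk _)) ?orbT //.
by case: k {IHk} => // k; rewrite leq_exp2r ?leq_pred.
Qed.

Section EndHomogeneous.

Variables (k N : nat) (chi : coloring N).

Definition end_homogeneous (A C : {set 'I_N}) := forall e : {set 'I_N},
  e \subset A -> #|e| = k ->
  {in A :|: C &, forall y z : 'I_N, {in e, forall a : 'I_N, a < y} ->
     {in e, forall a : 'I_N, a < z} -> chi (y |: e) = chi (z |: e)}.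

(** Greedy construction: move the least element of the reservoir [C] into [A], then thin [C] until
    the color of [y |: e] is constant for each of the at most [M ^ k] sets [e]. The successor in
    [(M ^ k).+1] is one more factor 2, paying for the vertex moved. *)
Lemma end_homogeneous_prefix (M l : nat) (X : {set 'I_N}) : 0 < k -> l <= M ->
  2 ^ (M * (M ^ k).+1) <= #|X| ->
  exists A C : {set 'I_N}, [/\ A \subset X, C \subset X, #|A| = l &
    [/\ {in A & C, forall a c : 'I_N, a < c},
    2 ^ ((M - l) * (M ^ k).+1) <= #|C| & end_homogeneous A C]].
Proof.
move=> k_gt0 + MX; elim: l => [|l IHl] lM.
  exists set0, X; rewrite sub0set subxx cards0 subn0; split=> //; split=> //.
    by move=> a c; rewrite inE.
  by move=> e; rewrite subset0 => /eqP ->; rewrite cards0 => k0; rewrite -k0 in k_gt0.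
have [A [C [AX CX Al [AC cC hom]]]] := IHl (ltnW lM).
have C0 : 0 < #|C| by apply: leq_trans cC; rewrite expn_gt0.
have [c0 c0C] := card_gt0P C0.
have [c cC0 c_min] := @arg_minnP _ c0 (mem C) (fun c => c : nat) c0C.
have cC' : c \in C := cC0.
pose s := enum [set e : {set 'I_N} | (e \subset c |: A) && (#|e| == k)].
have cA : c \notin A by apply/negP => cA; have := AC _ _ cA cC'; rewrite ltnn.
have cAl : #|c |: A| = l.+1 by rewrite cardsU1 cA Al.
have ss : size s <= M ^ k.
  rewrite -cardE cards_draws cAl; apply: leq_trans (bin_leq_exp _ _) _.
  by case: (k) => // k'; rewrite leq_exp2r.
have [C' [C'C cCC' const]] :=
  constant_subset (fun (e : {set 'I_N}) y => chi (y |: e)) s (C :\ c).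
have C'lt y : y \in C' -> c < y.
  move/(subsetP C'C); rewrite !inE => /andP[yc yC].
  by rewrite ltn_neqAle c_min // andbT eq_sym.
exists (c |: A), C'; split.
- by rewrite subUset AX sub1set (subsetP CX).
- by apply: subset_trans C'C _; apply: subset_trans (subD1set _ _) CX.
- exact: cAl.
split.
- move=> a y; rewrite !inE => /orP[/eqP -> /C'lt //|aA] /(subsetP C'C).
  by rewrite !inE => /andP[_]; apply: AC.
- have := cardsD1 c C; rewrite cC' => cD.
  set Q := M ^ k in cC ss *; set q := (M - l.+1) * Q.+1.
  have qE : (M - l) * Q.+1 = Q.+1 + q by rewrite /q -mulSn subnSK.
  rewrite qE expnD expnS in cC.
  rewrite -(leq_pmul2r (_ : 0 < 2 ^ Q)) ?expn_gt0 //.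
  apply: leq_trans (_ : #|C :\ c| <= _); last first.
    by apply: leq_trans cCC' _; rewrite leq_mul2l leq_exp2l ?ss ?orbT.
  have : 0 < 2 ^ q * 2 ^ Q by rewrite muln_gt0 !expn_gt0.
  by rewrite mulnC; lia.
- move=> e eA ek y z; rewrite -!setUA => yA zA ey ez.
  (* If [c] is in [e], anything above [e] lies in the thinned reservoir; otherwise [e] is a subset
     of the old [A]. *)
  case: (boolP (c \in e)) => ce.
    have inC' x : x \in c |: (A :|: C') -> {in e, forall a : 'I_N, a < x} -> x \in C'.
      rewrite !inE => + /(_ c ce) cx; case/or3P => // [/eqP xc|xA].
        by move: cx; rewrite xc ltnn.
      by have := AC _ _ xA cC'; rewrite ltnNge ltnW.
    apply: const; rewrite ?inC' // mem_enum inE eA ek eqxx //.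
  have eA' : e \subset A.
    apply/subsetP => a ae; have := subsetP eA a ae; rewrite !inE.
    by case: (eqVneq a c) ae => // ->; rewrite (negPf ce).
  have inAC x : x \in c |: (A :|: C') -> x \in A :|: C.
    rewrite !inE => /or3P[/eqP ->|->|/(subsetP C'C)]; rewrite ?cC' ?orbT //.
    by rewrite !inE => /andP[_ ->]; rewrite orbT.
  by apply: hom; rewrite ?inAC.
Qed.

End EndHomogeneous.

(** Fix [z] above the end-homogeneous set [A] and color [e] by [chi (z |: e)]. The largest vertex of
    any set of size [k.+1] in [A] may be replaced by [z], so a red clique extends by [z] and a blue
    path stays blue. *)
Lemma clique_or_path_step (k n M : nat) : 0 < k ->
  clique_or_path k n M -> clique_or_path k.+1 n (2 ^ (M * (M ^ k).+1)).
Proof.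
move=> k0 IH N X chi XM.
have [A [C [AX CX AM [AC C0 hom]]]] :=
  end_homogeneous_prefix chi k0 (leqnn M) XM.
have [z zC] : exists z, z \in C.
  by apply/card_gt0P; apply: leq_trans C0; rewrite expn_gt0.
have zA : z \notin A by apply/negP => zA; have := AC _ _ zA zC; rewrite ltnn.
have hom' (y : 'I_N) (e : {set 'I_N}) : y \in A -> e \subset A -> #|e| = k ->
    {in e, forall a : 'I_N, a < y} -> chi (y |: e) = chi (z |: e).
  move=> yA eA ek ey; apply: hom; rewrite ?inE ?yA ?zC ?orbT //.
  by move=> a /(subsetP eA) aA; apply: AC.
pose chi' : coloring N := fun e => chi (z |: e).
case: (IH N A chi' _) => [|[S [SA Sk red]]|[x [xA x_lt blue]]]; first by rewrite AM.
- left; exists (z |: S); split.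
  + by rewrite subUset sub1set (subsetP CX) // (subset_trans SA).
  + by rewrite cardsU1 Sk (contraNN _ zA) //; apply: (subsetP SA).
  move=> e eS ek; case: (boolP (z \in e)) => ze.
    rewrite -(setD1K ze); apply: red.
      apply/subsetP => a; rewrite !inE => /andP[/negPf az /(subsetP eS)].
      by rewrite !inE az.
    by have := cardsD1 z e; rewrite ze ek; lia.
  have eS' : e \subset S.
    apply/subsetP => a ae; have := subsetP eS a ae; rewrite !inE.
    by case: (eqVneq a z) ae => // ->; rewrite (negPf ze).
  have [y0 y0e] : exists y, y \in e by apply/card_gt0P; rewrite ek.
  have [y ye y_max] := @arg_maxnP _ y0 (mem e) (fun y => y : nat) y0e.
  have {}ye : y \in e := ye.
  have eyS : e :\ y \subset S by apply: subset_trans (subD1set _ _) eS'.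
  have eyk : #|e :\ y| = k by have := cardsD1 y e; rewrite ye ek; lia.
  rewrite -(setD1K ye) hom' //; first exact: red.
  + by rewrite (subsetP SA) // (subsetP eS').
  + exact: subset_trans SA.
  + move=> a; rewrite !inE => /andP[ay ae].
    by rewrite ltn_neqAle; apply/andP; split; [exact: ay|exact: y_max].
- right; exists x; split=> //; first by move=> i /xA; apply: (subsetP AX).
  move=> j jk.
  have -> : [set a in map x (iota j k.+1)] =
            x (j + k) |: [set a in map x (iota j k)].
    by apply/setP => a; rewrite -addn1 iotaD map_cat !inE mem_cat /= inE orbC.
  have inA i : i < k -> x (j + i) \in A by move=> ik; apply: xA; lia.
  rewrite hom'; first by apply: blue; lia.
  + by apply: xA; lia.
  + apply/subsetP => a; rewrite inE => /mapP[i]; rewrite mem_iota => ijk ->.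
    by apply: xA; lia.
  + rewrite cardsE -[RHS](size_iota j) -(size_map x); apply/card_uniqP.
    rewrite map_inj_in_uniq ?iota_uniq // => i i'; rewrite !mem_iota => hi hi' xii'.
    case: (ltngtP i i') => // ii.
      by have := x_lt i i'; rewrite xii' ltnn ii /=; lia.
    by have := x_lt i' i; rewrite xii' ltnn ii /=; lia.
  + move=> a; rewrite inE => /mapP[i]; rewrite mem_iota => ijk ->.
    by apply: x_lt; lia.
Qed.

(** * Lower bound: colorings of walks *)

Definition window (T : Type) (x : nat -> T) (j k : nat) := map x (iota j k).

(* Vertices of a walk may repeat, but consecutive ones are distinct; [true] is
   red, as in [coloring]. *)
Definition walk_coloring (k n : nat) (T : eqType) := exists c : seq T -> bool,
  (forall x : nat -> T, (forall i, i.+1 < n -> x i != x i.+1) ->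
     exists2 j, j + k <= n & c (window x j k)) /\
  (forall x : nat -> T, (forall i, i < k -> x i != x i.+1) ->
     ~~ (c (window x 0 k) && c (window x 1 k))).

Lemma walk_coloring_inj (k n : nat) (S T : eqType) (h : S -> T) :
  injective h -> walk_coloring k n T -> walk_coloring k n S.
Proof.
move=> h_inj [c [blue red]]; exists (fun s => c (map h s)).
have hx (x : nat -> S) j : map h (window x j k) = window (h \o x) j k.
  by rewrite /window -map_comp.
split=> x x_walk.
  case: (blue (h \o x)) => [i /x_walk|j jn cj]; first by rewrite /= (inj_eq h_inj).
  by exists j; rewrite ?hx.
by rewrite !hx; apply: red => i /x_walk; rewrite /= (inj_eq h_inj).
Qed.

(** Red means that the middle is a strict local minimum. A walk without one rises and then falls,
    each for fewer than [w] steps. *)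
Lemma walk_coloring3 (w : nat) : walk_coloring 3 (2 * w).+1 'I_w.
Proof.
exists (fun s : seq 'I_w => if s is [:: a; b; d] then (b < a) && (b < d) else false).
split=> [x x_walk|x _] /=; last by rewrite andbC; lia.
have lt_neq i : i.+1 < (2 * w).+1 -> x i < x i.+1 \/ x i.+1 < x i.
  move/x_walk; case: (ltngtP (x i) (x i.+1)) => [||/val_inj ->]; rewrite ?eqxx; by auto.
pose valley j := (x j.+1 < x j) && (x j.+1 < x j.+2).
case: (boolP [exists j : 'I_(2 * w), (j.+2 < (2 * w).+1) && valley j]).
  by move=> /existsP[j /andP[jw vj]]; exists (val j); rewrite ?addn3.
rewrite negb_exists => /forallP novalley.
have descend i : i.+2 < (2 * w).+1 -> x i.+1 < x i -> x i.+2 < x i.+1.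
  move=> iw xi; have iw' : i < 2 * w by lia.
  have := novalley (Ordinal iw'); rewrite /= iw /valley xi /=.
  by have := lt_neq i.+1 iw; lia.
have descent i : i <= w -> i < 2 * w -> ~ x i.+1 < x i.
  move=> iw iw2 xi.
  have chain l : i + l.+1 < (2 * w).+1 -> x (i + l.+1) < x (i + l).
    elim: l => [|l IHl] il; first by rewrite addn1 addn0.
    have := descend (i + l); rewrite -!addnS; apply; first by lia.
    by apply: IHl; lia.
  have drop l : i + l < (2 * w).+1 -> x (i + l) + l <= x i.
    elim: l => [|l IHl] il; first by rewrite !addn0.
    by have := chain l il; have := IHl; lia.
  by have := drop (2 * w - i); have := ltn_ord (x i); lia.
have climb i : i <= w -> i <= x i.
  elim: i => // i IHi iw; have := descent i; have := lt_neq i; have := IHi; lia.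
by have := climb w; have := ltn_ord (x w); lia.
Qed.

Lemma walk_coloring_step (k n w : nat) :
  walk_coloring k n ('I_w.+1 * bool)%type ->
  walk_coloring k.+1 n.+1 {ffun 'I_w.+1 -> bool}.
Proof.
move=> [c [blue red]].
(* The default [ord0] is taken only when [g = h], which never happens along a walk. *)
pose delta (g h : {ffun 'I_w.+1 -> bool}) :=
  let i := odflt ord0 [pick i | g i != h i] in (i, h i).
have deltaE (g h : {ffun 'I_w.+1 -> bool}) : g != h -> g (delta g h).1 != h (delta g h).1.
  move=> gh; rewrite /delta; case: pickP => [i //|eq_gh].
  by case/eqP: gh; apply/ffunP => i; apply/eqP; rewrite -[_ == _]negbK eq_gh.
have delta2 (g h : {ffun 'I_w.+1 -> bool}) : (delta g h).2 = h (delta g h).1 by [].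
(* If both were [(i, b)], then [h i = b = k' i], although [h] and [k'] differ at [i]. *)
have delta_neq (g h k' : {ffun 'I_w.+1 -> bool}) : h != k' -> delta g h != delta h k'.
  move=> /deltaE; apply: contraNneq => E.
  by rewrite -delta2 -E -delta2.
pose c' (s : seq {ffun 'I_w.+1 -> bool}) := if s is a :: s' then c (pairmap delta a s') else false.
have c'E (x : nat -> {ffun 'I_w.+1 -> bool}) j : c' (window x j k.+1) = c (window (fun i => delta (x i) (x i.+1)) j k).
  rewrite /window /=; congr c; elim: (k) j => //= l IHl j.
  by rewrite IHl.
exists c'; split=> x x_walk.
  case: (blue (fun i => delta (x i) (x i.+1))) => [i iN|j jn cj].
    by apply: delta_neq; apply: x_walk.
  by exists j; rewrite ?c'E // addnS.
rewrite !c'E; apply: (red (fun i => delta (x i) (x i.+1))) => i ik.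
by apply: delta_neq; apply: x_walk.
Qed.

(** The exponent is halved because its product with [bool] has to inject into the previous set. *)
Fixpoint lower_size (w l : nat) : nat :=
  if l is l'.+1 then 2 ^ (lower_size w l')./2 else w.

Lemma walk_coloring_lower_size (w l : nat) : 1 < w ->
  1 < lower_size w l /\
  walk_coloring (l + 3) ((2 * w).+1 + l) 'I_(lower_size w l).
Proof.
move=> w1; elim: l => [|l [M1 IHl]].
  by split=> //; rewrite addn0; apply: walk_coloring3.
rewrite /=; case ME: (half (lower_size w l)) => [|M]; first by lia.
split; first by rewrite -{1}(expn0 2) ltn_exp2l.
have cT : #|{ffun 'I_M.+1 -> bool}| = 2 ^ M.+1 by rewrite card_ffun card_bool card_ord.
rewrite (addSn l) (addnS _ l).
apply: (@walk_coloring_inj _ _ _ _ (enum_val \o cast_ord (esym cT))).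
  by move=> i j /= /enum_val_inj /cast_ord_inj.
apply: walk_coloring_step.
have cP : #|{: 'I_M.+1 * bool}| <= lower_size w l.
  by rewrite card_prod card_bool card_ord; lia.
apply: (walk_coloring_inj (h := fun p => widen_ord cP (enum_rank p)) _ IHl).
by move=> p q /(congr1 val) /= /val_inj /enum_rank_inj.
Qed.

(** * From walks and subsets to Ramsey numbers *)

Lemma enum_ord_sorted (N : nat) (S : {set 'I_N}) :
  sorted (fun a b : 'I_N => a < b) (enum S).
Proof.
rewrite /enum_mem -enumT; apply: sorted_filter.
  by move=> a b c; apply: ltn_trans.
by have := iota_ltn_sorted 0 N; rewrite -val_enum_ord sorted_map.
Qed.

Lemma enum_set_window (N k n j : nat) (x : 'I_n -> 'I_N) (y : nat -> 'I_N) :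
  (forall i i' : 'I_n, i < i' -> x i < x i') -> (forall i : 'I_n, y i = x i) ->
  j + k <= n ->
  enum [set x i | i : 'I_n & j <= i < j + k] = window y j k.
Proof.
move=> x_lt yx jk.
have y_lt i i' : i < i' < n -> y i < y i'.
  move=> /andP[ii i'n]; have i_n := ltn_trans ii i'n.
  by rewrite (yx (Ordinal i_n)) (yx (Ordinal i'n)) x_lt.
have lt_tr : transitive (fun a b : 'I_N => a < b) by move=> a b c; apply: ltn_trans.
apply: (irr_sorted_eq lt_tr) => [a|||a]; first by rewrite ltnn.
- exact: enum_ord_sorted.
- rewrite /window sorted_map.
  apply: (@sub_in_sorted _ (mem (iota j k)) ltn); last exact: iota_ltn_sorted.
    by move=> i i'; rewrite !mem_iota => hi hi' ii; apply: y_lt; lia.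
  by apply/allP.
- rewrite mem_enum; apply/imsetP/mapP => [[i]|[i]].
    rewrite inE => /andP[ji ij] ->; exists (i : nat); last by rewrite yx.
    by rewrite mem_iota ji.
  rewrite mem_iota => /andP[ji ij] ->; have i_n := leq_trans ij jk.
  exists (Ordinal i_n); first by rewrite inE /= ji.
  by rewrite -(yx (Ordinal i_n)).
Qed.

(** Color a set by its increasing enumeration. The two windows of a red clique on [k.+1] vertices
    would be consecutive and both red, and a blue path would be a walk without a red window. *)
Lemma walk_coloring_ramsey (k n n' N : nat) : n' <= n ->
  0 < n -> walk_coloring k n' 'I_N -> ~ ramsey_arrows k k.+1 n N.
Proof.
move=> n'n n0 [c [blue red]] arrow.
have N0 : 0 < N.
  case: (arrow (fun=> false)) => [[S [Sk _]]|[x _]].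
    by have := max_card S; rewrite Sk card_ord; apply: leq_trans.
  exact: leq_ltn_trans (ltn_ord (x (Ordinal n0))).
case: (arrow (fun e => c (enum e))) => [[S [Sk redS]]|[x [x_lt blue_x]]].
  pose y i := nth (Ordinal N0) (enum S) i.
  have Sk' : size (enum S) = k.+1 by rewrite -cardE.
  pose x (i : 'I_k.+1) := y i.
  have x_lt (i i' : 'I_k.+1) : i < i' -> x i < x i'.
    move=> ii; apply: (sorted_ltn_nth _ (Ordinal N0) (enum_ord_sorted S)) => //.
    + by move=> a b d; apply: ltn_trans.
    + by rewrite inE Sk'.
    + by rewrite inE Sk'.
  have red_window j : j + k <= k.+1 -> c (window y j k).
    move=> jk; rewrite -(enum_set_window (x := x)) //; apply: redS.
      apply/subsetP => a /imsetP[i _ ->].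
      by rewrite -mem_enum mem_nth // Sk'.
    by rewrite cardE (enum_set_window (y := y)) // size_map size_iota.
  suff /red : forall i, i < k -> y i != y i.+1 by rewrite !red_window.
  move=> i ik; have i_k : i < k.+1 by apply: ltnW.
  have ik' : i.+1 < k.+1 by [].
  by have := x_lt (Ordinal i_k) (Ordinal ik'); rewrite /x neq_ltn /= => ->.
pose y (i : nat) := if insub i is Some i' then x i' else Ordinal N0.
have yx (i : 'I_n) : y i = x i by rewrite /y valK.
have y_lt i i' : i < i' < n -> y i < y i'.
  move=> /andP[ii i'n]; have i_n := ltn_trans ii i'n.
  by rewrite (yx (Ordinal i_n)) (yx (Ordinal i'n)) x_lt.
case: (blue y) => [i i_n|j jn cj].
  by rewrite neq_ltn /= y_lt // ltnSn; lia.
have := blue_x j (leq_trans jn n'n).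
by rewrite (@enum_set_window _ _ _ _ _ y) ?cj //; lia.
Qed.

Lemma clique_or_path_ramsey (k n M : nat) :
  clique_or_path k n M -> exists2 r, is_ramsey_number k k.+1 n r & r <= M.
Proof.
move=> arrow.
have arrowM : `[< ramsey_arrows k k.+1 n M >].
  apply/asboolP => chi.
  have [|[S [_ Sk red]]|[x [_ x_lt blue]]] := arrow M [set: 'I_M] chi.
  - by rewrite cardsT card_ord.
  - by left; exists S.
  right; exists (fun i : 'I_n => x i); split.
    by move=> i j ij; apply: x_lt; rewrite ij ltn_ord.
  move=> j jk; apply/negbTE; have := blue j jk; congr (~~ chi _).
  apply/setP => a; rewrite inE; apply/mapP/imsetP => [[i]|[i]].
    rewrite mem_iota => /andP[ji ij] ->; have i_n := leq_trans ij jk.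
    by exists (Ordinal i_n); rewrite // inE /= ji.
  by rewrite inE => ij ->; exists (i : nat); rewrite // mem_iota.
case: (ex_minnP (ex_intro (fun N => `[< ramsey_arrows k k.+1 n N >]) M arrowM)).
move=> r /asboolP r_arrow r_min.
exists r; last exact: r_min.
by split=> // N /asboolP; apply: r_min.
Qed.

Lemma clique_or_path_le (k n M M' : nat) :
  M <= M' -> clique_or_path k n M -> clique_or_path k n M'.
Proof. by move=> MM arrow N X chi /(leq_trans MM); apply: arrow. Qed.

(** * Estimates: polynomials and towers *)

Lemma clique_or_path3_poly (n : nat) : 64 <= n -> clique_or_path 3 n (n ^ 15).
Proof.
move=> n64; pose i := (trunc_log 2 n).+1.
have n0 : 0 < n by apply: leq_trans n64.
have ni : n < 2 ^ i by apply: trunc_log_ltn.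
have i2n : 2 ^ i <= 2 * n by rewrite expnS leq_mul2l trunc_logP.
apply: clique_or_path_le (clique_or_path3 (i := i) _); last by rewrite ni andbT; lia.
have -> : 16 ^ (i + i) = (2 ^ i) ^ 8.
  by rewrite (_ : 16 = 2 ^ 4) // -!expnM; congr (2 ^ _); lia.
(* The bound is at most [2 ^ 11 * (2 * n) ^ 11 = 2 ^ 22 * n ^ 11], and
   [2 ^ 22 <= 64 ^ 4 <= n ^ 4]. *)
rewrite -mulnA; apply: leq_trans (_ : 2 ^ 11 * (2 * n) ^ 11 <= _).
  apply: leq_mul; first by [].
  by rewrite (expnD _ 3 8) leq_mul // leq_exp2r //; lia.
rewrite -expnMn mulnA expnMn (expnD n 4 11) leq_mul2r; apply/orP; right.
apply: leq_trans (_ : 64 ^ 4 <= _); last by rewrite leq_exp2r.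
have -> : 64 = 2 ^ 6 by [].
have -> : 2 * 2 = 2 ^ 2 by [].
by rewrite -!expnM leq_exp2l.
Qed.

Fixpoint ntwr (l y : nat) : nat := if l is l'.+1 then 2 ^ ntwr l' y else y.

Lemma ltn_ntwr (l y z : nat) : y < z -> ntwr l y < ntwr l z.
Proof. by move=> yz; elim: l => //= l; rewrite ltn_exp2l. Qed.

Lemma ntwr_gt0 (l y : nat) : 0 < y -> 0 < ntwr l y.
Proof. by case: l => //= l; rewrite expn_gt0. Qed.

Lemma mul_ntwr (l c y : nat) : 0 < c -> 0 < y -> c * ntwr l y <= ntwr l (c * y).
Proof.
move=> c0 y0; elim: l => //= l IHl.
apply: leq_trans (leq_pexp2l _ IHl) => //.
have := ntwr_gt0 l y0; move: (ntwr l y) => t t0.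
have -> : c * t = t + c.-1 * t by rewrite -mulSn prednK.
rewrite expnD mulnC leq_mul2l; apply/orP; right.
have : c.-1 < 2 ^ c.-1 by apply: ltn_expl.
move/leq_trans; rewrite prednK //; apply.
by rewrite leq_exp2l // leq_pmulr.
Qed.

Lemma clique_or_path_twr (l : nat) : exists C, forall n, 64 <= n ->
  clique_or_path (l + 4) n (ntwr l.+1 (C * n ^ 60)).
Proof.
suff [C [C0 arrow]] : exists C, 0 < C /\ forall n, 64 <= n ->
  clique_or_path (l + 4) n (ntwr l.+1 (C * n ^ 60)) by exists C.
elim: l => [|l [C [C0 IHl]]].
  (* With [M = n ^ 15] the exponent [M * (M ^ 3).+1] is [n ^ 60 + n ^ 15]. *)
  exists 2; split=> // n n64.
  have := clique_or_path_step (isT : 0 < 3) (clique_or_path3_poly n64).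
  apply: clique_or_path_le; rewrite /= leq_exp2l // -expnM mulnS -expnD.
  have : n ^ 15 <= n ^ 60 by rewrite leq_pexp2l //; lia.
  by rewrite mul2n -addnn leq_add2r.
exists ((l + 6) * C); split=> [|n n64]; first by rewrite muln_gt0 C0 addnS.
have k0 : 0 < l + 4 by rewrite addnS.
have := clique_or_path_step k0 (IHl n n64).
rewrite addSn; apply: clique_or_path_le.
set y := C * n ^ 60; rewrite -mulnA -/y.
have y0 : 0 < y by rewrite muln_gt0 C0 expn_gt0; lia.
rewrite [ntwr l.+2 _]/= leq_exp2l //.
(* The step exponent [M * (M ^ (l + 4)).+1] is at most [M ^ (l + 6)]; as [M] is a power of 2, this
   power multiplies its exponent by [l + 6], which [mul_ntwr] moves to the base of the tower. *)
apply: leq_trans (_ : ntwr l.+1 y ^ (l + 6) <= _).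
  have M2 : 1 < ntwr l.+1 y by rewrite /= -{1}(expn0 2) ltn_exp2l // ntwr_gt0.
  move: (ntwr l.+1 y) M2 => M M2; rewrite !addnS !addn0 !expnS.
  have : 0 < M ^ l by rewrite expn_gt0; lia.
  move: (M ^ l) => P P0.
  set Q := M * (M * (M * (M * P))).
  have -> : M * Q.+1 = M * Q + M by rewrite mulnS addnC.
  have MQ : M <= Q by rewrite leq_pmulr // !muln_gt0 P0; lia.
  nia.
rewrite /= -expnM leq_exp2l // mulnC.
by apply: mul_ntwr; rewrite ?addnS.
Qed.

(** The slack [4 * t + 4] survives the halved exponent: half of it is [2 * t + 2], and
    [2 ^ (2 * t + 1)] exceeds [4 * 2 ^ t + 4] for [t >= 2]. *)
Lemma lower_size_ntwr (w l s : nat) : 2 <= s -> 4 * s + 4 <= w ->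
  4 * ntwr l s + 4 <= lower_size w l.
Proof.
move=> s2 sw.
suff [] : 2 <= ntwr l s /\ 4 * ntwr l s + 4 <= lower_size w l by [].
elim: l => [|l [t2 IHl]] //=.
move: (ntwr l s) (lower_size w l) t2 IHl => t m t2 tm.
have t4 : 4 <= 2 ^ t by apply: (leq_pexp2l (isT : 0 < 2) t2).
split; first by apply: leq_trans t4.
apply: leq_trans (_ : 2 ^ (t + t).+1 <= _); last by rewrite leq_exp2l //; lia.
by rewrite expnS expnD; nia.
Qed.

Lemma ntwr_lt_ramsey (l s n r : nat) : 2 <= s -> 8 * s + 10 + l <= n ->
  is_ramsey_number (l + 3) (l + 3).+1 n r -> ntwr l s < r.
Proof.
move=> s2 sn [arrow _]; rewrite ltnNge; apply/negP => rs.
pose w := 4 * s + 4.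
have [_ col] := @walk_coloring_lower_size w l (ltac:(lia)).
have rw : r <= lower_size w l.
  by have := lower_size_ntwr l s2 (leqnn w); move: rs; lia.
have wn : (2 * w).+1 + l <= n by rewrite /w; lia.
have n0 : 0 < n by lia.
apply: (walk_coloring_ramsey wn n0 _ arrow).
apply: (walk_coloring_inj (h := widen_ord rw)) col.
by move=> i j /(congr1 val) /= /val_inj.
Qed.

(** * Real towers and the final choice of constants *)

Section RealTower.

Local Open Scope ring_scope.

Variable R : realType.

Lemma twrS (l : nat) (x : R) : twr l.+2 x = 2 `^ twr l.+1 x.
Proof. by []. Qed.

Lemma twr_natr (l y : nat) : twr l.+1 (y%:R : R) = (ntwr l y)%:R.
Proof.
elim: l => // l IHl.
by rewrite twrS IHl powR_mulrn // -natrX.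
Qed.

Lemma ler_twr (l : nat) (x y : R) : x <= y -> twr l.+1 x <= twr l.+1 y.
Proof.
move=> xy; elim: l => // l IHl.
by rewrite !twrS ler_powR // ler1n.
Qed.

End RealTower.

Theorem theorem2 (R : realType) :
  (exists n0 : nat, forall n : nat, (n0 <= n)%N ->
     exists r : nat, is_ramsey_number 3 4 n r /\ (r < n ^ 21)%N) /\
  (forall k : nat, (3 <= k)%N ->
     exists c : R, (0 < c)%R /\
       exists n0 : nat, forall n : nat, (n0 <= n)%N ->
         exists r : nat, is_ramsey_number k k.+1 n r /\
           (twr (k - 2) (n%:R `^ c) < r%:R)%R /\
           (r%:R < twr (k - 2) (n%:R ^+ 62 : R))%R).
Proof.
split.
  exists 64 => n n64.
  have [r r_num rn] := clique_or_path_ramsey (clique_or_path3_poly n64).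
  by exists r; split=> //; apply: leq_ltn_trans rn _; rewrite ltn_exp2l //; lia.
move=> k k3; have [l ->] : exists l, k = l + 3 by exists (k - 3); lia.
have -> : l + 3 - 2 = l.+1 by lia.
have [n1 upper] : exists n1, forall n, n1 <= n ->
    exists2 M, clique_or_path (l + 3) n M & M < ntwr l (n ^ 62).
  case: l => [|l].
    exists 64 => n n64; exists (n ^ 15); first exact: clique_or_path3_poly.
    by rewrite /= ltn_exp2l //; lia.
  have [C arrow] := clique_or_path_twr l.
  exists (64 + C) => n nC; exists (ntwr l.+1 (C * n ^ 60)).
    by rewrite addSn -addnS; apply: arrow; lia.
  apply: ltn_ntwr; rewrite (expnD n 2 60) ltn_pmul2r ?expn_gt0; last lia.
  by rewrite -mulnn; nia.
(* A walk bound linear in [s] leaves room for [s] of order the square root of [n]. *)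
exists (2^-1)%R; split; first by rewrite invr_gt0 ltr0n.
exists (n1 + 400 + 2 * l) => n nn.
case: (upper n) => [|M arrow Mn]; first lia.
have [r r_num rM] := clique_or_path_ramsey arrow.
exists r; split=> //; split; last first.
  by rewrite -natrX twr_natr ltr_nat (leq_ltn_trans rM).
(* [s] is a power of 2 between the square root of [n] and twice that root. *)
pose t := trunc_log 4 n; pose s := 2 ^ t.+1.
have n0 : 0 < n by lia.
have ns : n <= s ^ 2.
  by rewrite /s -expnM mulnC (expnM 2 2) ltnW // trunc_log_ltn.
have sn : s ^ 2 <= 4 * n.
  by rewrite /s -expnM mulnC (expnM 2 2) expnS leq_mul2l trunc_logP.
apply: le_lt_trans (_ : (twr l.+1 (s%:R : R) < _)%R).
  apply: ler_twr.
  rewrite powR12_sqrt // -[leRHS]ger0_norm // -sqrtr_sqr ler_wsqrtr //.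
  by rewrite -natrX ler_nat.
rewrite twr_natr ltr_nat; apply: ntwr_lt_ramsey r_num.
  by rewrite /s expnS leq_pmulr // expn_gt0.
(* From [(s - 32) ^ 2 >= 0]. With [s ^ 2 <= 4 * n] it gives [8 * s <= n / 2 + 128], and
   [n >= 400 + 2 * l] absorbs the rest. *)
have : 64 * s <= s ^ 2 + 1024 by rewrite -mulnn; case: (leqP s 32) => h; nia.
lia.
Qed.
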